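(* Let $\tau=\tau^0\mbox{-}\tau^1\mbox{-}\cdots\mbox{-}\tau^s$ and $\phi=\phi^0\mbox{-}\phi^1\mbox{-}\cdots\mbox{-}\phi^s$ be multi-patterns such that the sequence $(\tau^0,\tau^1,\dots,\tau^s)$ is a rearrangement of the sequence $(\phi^0,\phi^1,\dots,\phi^s)$. Then $\tau\equiv\phi$.
   Context: $[k]^n$ = words of length $n$ over $\{1,\dots,k\}$. A generalized pattern with no hyphens is a word over $[m]$ using every letter of $[m]$. A multi-pattern $\tau^0\mbox{-}\tau^1\mbox{-}\cdots\mbox{-}\tau^s$ (each $\tau^i$ a generalized pattern with no hyphens) is the pattern obtained by concatenating the $\tau^i$ with hyphens between consecutive blocks, where every letter of $\tau^i$ is incomparable with every letter of $\tau^j$ for $i\ne j$. A word $\sigma$ contains it if $\sigma$ has occurrences (as factors of consecutive letters, order-isomorphic to the block, with equalities preserved) of $\tau^0,\dots,\tau^s$ in this left-to-right order, pairwise non-overlapping; otherwise $\sigma$ avoids it. Two patterns are equivalent ($\equiv$) if for every $k$ and $n$ the numbers of words in $[k]^n$ avoiding them are equal. *)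

(* Defs.v *)
From mathcomp Require Import all_boot.

Set Implicit Arguments.
Unset Strict Implicit.
Unset Printing Implicit Defensive.

(* A hyphen-free generalized pattern: a word whose set of letters is exactly
   {1, ..., m} for some m. *)
Definition gen_pattern (p : seq nat) : Prop :=
  exists m : nat, forall x : nat, (x \in p) = (1 <= x <= m).

(* tau^0-tau^1-...-tau^s, given by its s + 1 blocks; letters of different
   blocks are incomparable, so they are never compared below. *)
Definition multi_pattern (s : nat) := s.+1.-tuple (seq nat).

Definition is_multi_pattern (s : nat) (tau : multi_pattern s) : Prop :=
  forall i : 'I_s.+1, gen_pattern (tnth tau i).

Definition order_iso (u v : seq nat) : bool :=
  (size u == size v) &&
  [forall a : 'I_(size v), forall b : 'I_(size v),
     ((nth 0 u a < nth 0 u b) == (nth 0 v a < nth 0 v b)) &&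
     ((nth 0 u a == nth 0 u b) == (nth 0 v a == nth 0 v b))].

Definition occurs_at (p u : seq nat) (i : nat) : bool :=
  (i + size p <= size u) && order_iso (take (size p) (drop i u)) p.

(* A word of [k]^n is an n.-tuple 'I_k: the letters are 0, ..., k - 1 instead
   of 1, ..., k, which is harmless since only their relative order matters. *)
Definition word_nat (k n : nat) (w : n.-tuple 'I_k) : seq nat :=
  [seq val x | x <- w].

(* pos i is the starting position (from 0) of the occurrence of the block i. *)
Definition contains (s k n : nat) (tau : multi_pattern s)
    (w : n.-tuple 'I_k) : bool :=
  [exists pos : {ffun 'I_s.+1 -> 'I_n.+1},
     [forall i, occurs_at (tnth tau i) (word_nat w) (pos i)] &&
     [forall i : 'I_s.+1, forall j : 'I_s.+1,
        (i < j) ==> (pos i + size (tnth tau i) <= pos j)]].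

Definition avoids (s k n : nat) (tau : multi_pattern s)
    (w : n.-tuple 'I_k) : bool := ~~ contains tau w.

Definition num_avoiding (s : nat) (tau : multi_pattern s) (k n : nat) : nat :=
  #|[set w : n.-tuple 'I_k | avoids tau w]|.

Definition pattern_equiv (s t : nat) (tau : multi_pattern s)
    (phi : multi_pattern t) : Prop :=
  forall k n : nat, num_avoiding tau k n = num_avoiding phi k n.

(* Main.v *)
Require Import Defs.
From mathcomp Require Import all_boot.
From mathcomp Require Import ssralg poly zify.

Set Implicit Arguments.
Unset Strict Implicit.
Unset Printing Implicit Defensive.

(* A word contains p-L (first block p, remaining blocks L) exactly when, after
   cutting it at the end of the occurrence of p that ends first, the right part
   contains L.  Hence, for a fixed alphabet, the generating function of the words
   containing a multi-pattern is the product over its blocks p of the generating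
   functions of the words in which p occurs for the first time at the very end,
   times the generating function of all words; this product does not depend on
   the order of the blocks. *)

Definition occurs (p u : seq nat) : bool :=
  has (occurs_at p u) (iota 0 (size u).+1).

Fixpoint contains_blocks (L : seq (seq nat)) (u : seq nat) : bool :=
  if L is p :: L' then
    has (fun j => occurs p (take j u) && contains_blocks L' (drop j u))
        (iota 0 (size u).+1)
  else true.

(** Testing the single prefix one letter shorter suffices, since occurrence is monotone in the
    prefix. The disjunct [size u == 0] serves the empty pattern: the empty word equals its own
    truncation, which would otherwise rule it out. *)
Definition occurs_first_at_end (p u : seq nat) : bool :=
  occurs p u && ((size u == 0) || ~~ occurs p (take (size u).-1 u)).

Definition count_words (k n : nat) (P : pred (seq nat)) : nat :=
  #|[set w : n.-tuple 'I_k | P (word_nat w)]|.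

Lemma occursP p u : reflect (exists i, occurs_at p u i) (occurs p u).
Proof.
apply: (iffP hasP) => [[i _ hi]|[i hi]]; first by exists i.
by exists i => //; rewrite mem_iota; case/andP: hi => hi _; lia.
Qed.

Lemma occurs_at_drop p u j i : j <= size u ->
  occurs_at p (drop j u) i = occurs_at p u (j + i).
Proof.
by move=> hj; rewrite /occurs_at size_drop drop_drop [j + i]addnC; congr (_ && _); lia.
Qed.

Lemma occurs_at_take p u j i :
  occurs_at p (take j u) i = (i + size p <= j) && occurs_at p u i.
Proof.
rewrite /occurs_at size_take_min leq_min -andbA.
case: leqP => //= hj; congr (_ && _).
case: (leqP i j) => hij; last lia.
rewrite -{1}(subnK hij) -take_drop take_takel //; lia.
Qed.

Lemma occurs_take_le p u i j : i <= j -> occurs p (take i u) -> occurs p (take j u).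
Proof.
move=> hij /occursP[a]; rewrite occurs_at_take => /andP[ha hp].
by apply/occursP; exists a; rewrite occurs_at_take hp andbT; lia.
Qed.

Lemma contains_blocksP L u :
  reflect (exists pos : nat -> nat,
     (forall i, i < size L -> occurs_at (nth [::] L i) u (pos i)) /\
     (forall i j, i < j < size L -> pos i + size (nth [::] L i) <= pos j))
   (contains_blocks L u).
Proof.
elim: L u => [|p L IH] u.
  by apply: ReflectT; exists id; split=> // i j; rewrite ltn0 andbF.
apply: (iffP hasP).
  case=> j; rewrite mem_iota add0n => /andP[_ hj] /andP[/occursP[a]].
  rewrite occurs_at_take => /andP[haj ha] /IH[pos [h1 h2]].
  exists (fun i => if i is i'.+1 then j + pos i' else a); split.
    by case=> [//|i] /h1 /=; rewrite occurs_at_drop.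
  case=> [|i] [|i'] //= h; first lia.
  by rewrite -addnA leq_add2l; apply: h2.
case=> pos [h1 h2]; have h0 := h1 0 isT.
have hs : pos 0 + size p <= size u by case/andP: h0.
exists (pos 0 + size p); first by rewrite mem_iota; lia.
apply/andP; split.
  by apply/occursP; exists (pos 0); rewrite occurs_at_take leqnn.
have hle i : i < size L -> pos 0 + size p <= pos i.+1 by move=> hi; apply: (h2 0).
(* By [hle] all later blocks start at or after the cut, so the truncated subtraction is exact. *)
apply/IH; exists (fun i => pos i.+1 - (pos 0 + size p)); split.
  by move=> i hi; rewrite occurs_at_drop // subnKC ?hle //; apply: (h1 i.+1).
move=> i j /andP[hij hj]; have /= := h2 i.+1 j.+1; rewrite !ltnS hij hj => /(_ isT).
have := hle i (ltn_trans hij hj); lia.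
Qed.

(** Moving the cut left only lengthens the suffix: the same occurrences survive, shifted by
    [j - i]. *)
Lemma contains_blocks_drop_le L u i j : i <= j <= size u ->
  contains_blocks L (drop j u) -> contains_blocks L (drop i u).
Proof.
move=> /andP[hij hj] /contains_blocksP[pos [h1 h2]].
have hi := leq_trans hij hj.
apply/contains_blocksP; exists (fun a => (j - i) + pos a); split.
  move=> a /h1; rewrite !occurs_at_drop //.
  by rewrite addnA subnKC.
by move=> a b /h2; lia.
Qed.

Lemma containsE s k n (tau : multi_pattern s) (w : n.-tuple 'I_k) :
  contains tau w = contains_blocks tau (word_nat w).
Proof.
have nE (i : 'I_s.+1) : nth [::] tau i = tnth tau i by rewrite (tnth_nth [::]).
have sw : size (word_nat w) = n by rewrite size_map size_tuple.
apply/existsP/contains_blocksP.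
  case=> pos /andP[/forallP h1 /forallP h2].
  exists (fun i => nat_of_ord (pos (inord i))); rewrite size_tuple; split.
    by move=> i hi; rewrite -[i in nth _ _ i](inordK hi) nE; apply: h1.
  move=> i j /andP[hij hj]; have hi := ltn_trans hij hj.
  have /forallP/(_ (inord j))/implyP := h2 (inord i).
  by rewrite -nE !inordK //; apply.
rewrite size_tuple => -[pos [h1 h2]].
have hpos (i : 'I_s.+1) : pos i < n.+1.
  by have /andP[] := h1 i (ltn_ord i); rewrite sw; lia.
exists [ffun i => Ordinal (hpos i)]; apply/andP; split.
  by apply/forallP=> i; rewrite ffunE /= -nE; apply: h1.
apply/forallP=> i; apply/forallP=> j; apply/implyP=> hij.
by rewrite !ffunE /= -nE; apply: h2; rewrite hij ltn_ord.
Qed.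

(** At most one summand is nonzero, because only the shortest prefix containing [p] can satisfy
    [occurs_first_at_end p]. Writing the boolean as a sum lets it be summed over all words later. *)
Lemma contains_blocks_cons p L u :
  contains_blocks (p :: L) u =
    \sum_(j < (size u).+1)
      (occurs_first_at_end p (take j u) && contains_blocks L (drop j u)) :> nat.
Proof.
have sz (j : 'I_(size u).+1) : size (take j u) = j.
  by rewrite size_takel // -ltnS.
have tk (j : 'I_(size u).+1) : take j.-1 (take j u) = take j.-1 u.
  by rewrite take_takel // leq_pred.
have [/hasP[j hj /andP[hp hL]]|/hasPn no] := boolP (contains_blocks _ _).
  have ex : exists j, occurs p (take j u) by exists j.
  case: (ex_minnP ex) => m hm mmin.
  rewrite mem_iota add0n in hj; have hmj := mmin _ hp.
  have hmu : m < (size u).+1 by lia.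
  rewrite (bigD1 (Ordinal hmu)) //= big1 ?addn0.
    (* The cut [j] can be moved back to the minimal [m], and the suffix still contains [L]. *)
    rewrite (contains_blocks_drop_le _ hL) ?hmj ?andbT; last lia.
    have := tk (Ordinal hmu); have := sz (Ordinal hmu).
    rewrite /occurs_first_at_end /= => -> ->; rewrite hm /=.
    case: eqP => //= m0; case: (boolP (occurs _ _)) => // /mmin; lia.
  (* A cut [i < m] contradicts minimality; for [i > m] the prefix of length [i.-1] already contains
     [p]. *)
  move=> i /eqP hi; apply/eqP; rewrite eqb0; apply/nandP; left.
  rewrite /occurs_first_at_end sz tk; apply/negP=> /andP[/mmin hmi].
  have hne : m <> i by move=> e; apply: hi; apply: val_inj.
  case/orP=> [/eqP|/negP]; first lia.
  by apply; apply: occurs_take_le hm; lia.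
rewrite big1 // => i _; apply/eqP; rewrite eqb0.
apply: contra (no i _) => [/andP[/andP[hp _] hL]|]; first exact/andP.
by rewrite mem_iota add0n ltn_ord.
Qed.

Lemma count_wordsE k n P :
  count_words k n P = \sum_(w : n.-tuple 'I_k) P (word_nat w).
Proof.
rewrite /count_words -sum1_card big_mkcond /=; apply: eq_bigr => w _.
by rewrite inE; case: (P _).
Qed.

(** Concatenation is a bijection from pairs of words of lengths [j] and [m] onto words of length
    [j + m]. *)
Lemma count_words_split k j m (P Q : pred (seq nat)) :
  count_words k (j + m) (fun u => P (take j u) && Q (drop j u)) =
  count_words k j P * count_words k m Q.
Proof.
rewrite /count_words -cardsX.
pose f (x : j.-tuple 'I_k * m.-tuple 'I_k) := cat_tuple x.1 x.2.
have f_inj : injective f.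
  move=> [a b] [c d] /(congr1 val) /= /eqP.
  by rewrite eqseq_cat ?size_tuple // => /andP[/eqP/val_inj-> /eqP/val_inj->].
have wn a b : word_nat (f (a, b)) = word_nat a ++ word_nat b by rewrite /word_nat map_cat.
have sz n (a : n.-tuple 'I_k) : size (word_nat a) = n by rewrite size_map size_tuple.
rewrite -(card_imset _ f_inj); apply: eq_card => w; apply/idP/imsetP.
  rewrite inE => hw.
  have ht : size (take j w) == j by rewrite size_takel // size_tuple leq_addr.
  have hd : size (drop j w) == m by rewrite size_drop size_tuple addKn.
  exists (Tuple ht, Tuple hd); last by apply: val_inj; rewrite /= cat_take_drop.
  by rewrite !inE /word_nat /= map_take map_drop.
case=> -[a b]; rewrite !inE /= => /andP[ha hb] ->.
by rewrite wn take_size_cat ?drop_size_cat ?sz // ha hb.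
Qed.

Lemma count_contains_cons k n p L :
  count_words k n (contains_blocks (p :: L)) =
  \sum_(j < n.+1) count_words k j (occurs_first_at_end p) *
                  count_words k (n - j) (contains_blocks L).
Proof.
transitivity (\sum_(j < n.+1) count_words k n
   (fun u => occurs_first_at_end p (take j u) && contains_blocks L (drop j u))).
  (* Double counting of pairs (word, cut): exchange the two sums and collapse the inner one over
     cuts. *)
  under [RHS]eq_bigr do rewrite count_wordsE.
  rewrite exchange_big count_wordsE; apply: eq_bigr => w _.
  by rewrite contains_blocks_cons size_map size_tuple.
apply: eq_bigr => j _; rewrite -count_words_split subnKC //.
by rewrite -ltnS.
Qed.

(* Generating functions are truncated at degree N, which leaves the coefficients
   below N unaffected. *)
Lemma count_contains_coef k N L n : n < N ->
  count_words k n (contains_blocks L) =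
  (((\prod_(p <- L) \poly_(i < N) count_words k i (occurs_first_at_end p)) *
    \poly_(i < N) count_words k i (contains_blocks [::]))`_n)%R.
Proof.
elim: L n => [|p L IH] n hn; first by rewrite big_nil GRing.mul1r coef_poly hn.
rewrite big_cons -GRing.mulrA coefM count_contains_cons.
apply: eq_bigr => j _; have hj := ltn_ord j.
(* Both [j] and [n - j] stay below [N], so truncation affects neither factor. *)
by rewrite coef_poly IH ?(leq_ltn_trans _ hn) ?leq_subr // -ltnS.
Qed.

Theorem mainTheorem8 (s : nat) (tau phi : multi_pattern s)
    (htau : is_multi_pattern tau) (hphi : is_multi_pattern phi)
    (hperm : perm_eq tau phi) :
  pattern_equiv tau phi.
Proof.
move=> k n.
have avE (t : multi_pattern s) : num_avoiding t k n =
    #|{: n.-tuple 'I_k}| - count_words k n (contains_blocks t).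
  rewrite /num_avoiding /count_words -(cardsC [set w | contains_blocks t (word_nat w)]).
  by rewrite addKn; apply: eq_card => w; rewrite !inE /avoids containsE.
(* Truncating at [n.+1] keeps the coefficient of degree [n]; commutativity of the product absorbs
   the rearrangement of blocks. *)
by rewrite !avE !(count_contains_coef _ _ (ltnSn n)) (perm_big _ hperm).
Qed.
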